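(* Let $\mathcal X\subset\mathbb R^n$ be a nonempty closed convex set, $\|\cdot\|$ a norm on $\mathbb R^n$ with conjugate norm $\|\cdot\|_*$, and $h$ an $\mathcal X$-regularizer that is strongly convex (with modulus 1) with respect to $\|\cdot\|$. Let $L>0$ and let $f:\mathbb R^n\to\mathbb R\cup\{+\infty\}$ be a convex function, continuously differentiable on $\mathcal X$, with $\|\nabla f(x)-\nabla f(x')\|_*\le L\|x-x'\|$ for all $x,x'\in\mathcal X$. Assume that $f$ attains its minimum $f_*$ over $\mathcal X$ at some $x_*\in\mathcal X$, and that $x_*\in\operatorname{dom}h$. Let $\gamma_1=1/L$ and, for $t\ge1$, $$\gamma_{t+1}=(2L)^{-1}\Big(1+\sqrt{1+(2L\gamma_t)^2}\Big),\qquad\nu_t=(L\gamma_t)^{-1}.$$ Let $(x_t,y_t,z_t,\vartheta_t)_{t\ge1}$ satisfy $x_1=z_1=\nabla h^*(\vartheta_1)$ and, for $t\ge1$, $$y_t=(1-\nu_t)z_t+\nu_tx_t,\qquad(x_{t+1},\vartheta_{t+1})\in\Pi_h(\vartheta_t-\gamma_t\nabla f(y_t)),\qquad z_{t+1}=(1-\nu_t)z_t+\nu_tx_{t+1}.$$ Then for all $T\ge1$, $$f(z_{T+1})-f_*\le\frac{4L\,D_h(x_*,x_1;\vartheta_1)}{(T+1)^2}.$$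
   Context: $\langle\cdot,\cdot\rangle$ is the canonical scalar product on $\mathbb R^n$; $\|\vartheta\|_*=\max_{\|x\|\le1}\langle\vartheta,x\rangle$. For convex $g:\mathbb R^n\to\mathbb R\cup\{+\infty\}$: $\operatorname{dom}g=\{x:g(x)<\infty\}$; $\partial g(x)$ is the set of $\vartheta\in\mathbb R^n$ with $g(x')-g(x)\ge\langle\vartheta,x'-x\rangle$ for all $x'\in\mathbb R^n$; $g^*(\vartheta)=\sup_{x}\{\langle\vartheta,x\rangle-g(x)\}$; for $\vartheta\in\partial g(x)$, the Bregman divergence with subgradient $\vartheta$ is $D_g(x',x;\vartheta)=g(x')-g(x)-\langle\vartheta,x'-x\rangle$. $g$ is strongly convex (modulus 1) w.r.t. $\|\cdot\|$ if $g(\lambda x+(1-\lambda)x')\le\lambda g(x)+(1-\lambda)g(x')-\frac{\lambda(1-\lambda)}2\|x'-x\|^2$ for all $x,x'\in\mathbb R^n$, $\lambda\in[0,1]$. An $\mathcal X$-regularizer is a function $h:\mathbb R^n\to\mathbb R\cup\{+\infty\}$ that is strictly convex, lower-semicontinuous, with $\operatorname{cl}\operatorname{dom}h=\mathcal X$ and $\operatorname{dom}h^*=\mathbb R^n$; then $h^*$ is differentiable on $\mathbb R^n$, and $x=\nabla h^*(\vartheta)$ is equivalent to $\vartheta\in\partial h(x)$. The multi-valued prox-mapping $\Pi_h$: for $\zeta\in\mathbb R^n$, $\Pi_h(\zeta)$ is the set of couples $(x,\vartheta)\in\mathcal X\times\mathbb R^n$ with $x=\nabla h^*(\zeta)$,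 $\vartheta\in\partial h(x)$, and $\langle\vartheta-\zeta,x'-x\rangle\ge0$ for all $x'\in\mathcal X$. *)

(* Defs.v *)
From HB Require Import structures.
From mathcomp Require Import all_boot all_order all_algebra.
From mathcomp Require Import all_classical all_reals all_analysis.

Set Implicit Arguments.
Unset Strict Implicit.
Unset Printing Implicit Defensive.
Import Order.TTheory GRing.Theory Num.Theory.
Import numFieldNormedType.Exports.
Local Open Scope classical_set_scope.
Local Open Scope ring_scope.

Section Vectors.
Context {R : realType} {n : nat}.
Implicit Types u v : 'rV[R]_n.

Definition dot u v : R := \sum_(i < n) u ord0 i * v ord0 i.

Definition is_norm (N : 'rV[R]_n -> R) : Prop :=
  [/\ forall u v, N (u + v) <= N u + N v,
      forall (a : R) u, N (a *: u) = `|a| * N u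
    & forall u, N u = 0 -> u = 0].

(* The supremum is taken in the extended reals, where it always exists; it is
   the real number max_{N x <= 1} <v, x> whenever [N] is a norm. *)
Definition dual_norm (N : 'rV[R]_n -> R) v : \bar R :=
  ereal_sup [set (dot v x)%:E | x in [set x | N x <= 1]].

End Vectors.

(* A function R^n -> R U {+oo} is a map [g] to [\bar R] such that
   [g x != -oo] for all [x].  In [\bar R], 0 * +oo = 0 and +oo - +oo = -oo. *)
Section ExtendedFunctions.
Context {R : realType} {n : nat}.
Implicit Types (g : 'rV[R]_n -> \bar R) (x v : 'rV[R]_n).
Local Open Scope ereal_scope.

Definition dom g : set 'rV[R]_n := [set x | g x < +oo].

Definition convex_efun g : Prop :=
  forall x x' (l : R), (0 <= l <= 1)%R ->
    g (l *: x + (1 - l) *: x')%R <= l%:E * g x + (1 - l)%:E * g x'.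

Definition strictly_convex_efun g : Prop :=
  forall x x' (l : R), dom g x -> dom g x' -> x != x' -> (0 < l < 1)%R ->
    g (l *: x + (1 - l) *: x')%R < l%:E * g x + (1 - l)%:E * g x'.

Definition strongly_convex_efun (N : 'rV[R]_n -> R) g : Prop :=
  forall x x' (l : R), (0 <= l <= 1)%R ->
    g (l *: x + (1 - l) *: x')%R <=
      l%:E * g x + (1 - l)%:E * g x' -
      (l * (1 - l) / 2 * N (x' - x) ^+ 2)%:E.

(* If [g x = +oo], the condition fails at [x' = x]: the set is then empty. *)
Definition subdifferential g x : set 'rV[R]_n :=
  [set v | forall x', (dot v (x' - x))%:E <= g x' - g x].

Definition conjugate g v : \bar R :=
  ereal_sup [set (dot v x)%:E - g x | x in setT].

Definition bregman g x' x v : \bar R := g x' - g x - (dot v (x' - x))%:E.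

Definition differentiable_efun g x : Prop :=
  (\forall y \near x, g y \is a fin_num) /\ differentiable (fine \o g) x.

Definition grad g x : 'rV[R]_n :=
  (\row_i 'D_(delta_mx ord0 i) (fine \o g) x)%R.

Definition continuously_differentiable_on (X : set 'rV[R]_n) g : Prop :=
  (forall x, X x -> differentiable_efun g x) /\
  {within X, continuous (grad g)}.

Definition regularizer (X : set 'rV[R]_n) (h : 'rV[R]_n -> \bar R) : Prop :=
  [/\ forall x, h x != -oo,
      strictly_convex_efun h,
      lower_semicontinuous h,
      closure (dom h) = X
    & dom (conjugate h) = setT].

Definition prox (X : set 'rV[R]_n) (h : 'rV[R]_n -> \bar R) (zeta : 'rV[R]_n) :
    set ('rV[R]_n * 'rV[R]_n) :=
  [set p | [/\ X p.1,
               p.1 = grad (conjugate h) zeta,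
               subdifferential h p.1 p.2
             & forall x', X x' -> (0 <= dot (p.2 - zeta) (x' - p.1))%R]].

End ExtendedFunctions.

(* Main.v *)
Require Import Defs.
From HB Require Import structures.
From mathcomp Require Import all_boot all_order all_algebra.
From mathcomp Require Import all_classical all_reals all_analysis.
From mathcomp Require Import ring lra.
Set Implicit Arguments.
Unset Strict Implicit.
Unset Printing Implicit Defensive.
Import Order.TTheory GRing.Theory Num.Theory.
Import numFieldNormedType.Exports.
Local Open Scope classical_set_scope.
Local Open Scope ring_scope.

(* With [D t] the Bregman divergence of [xstar] from [x t], the inequality
   defining the prox-mapping and the strong convexity of [h] give
     gamma_t <grad f(y_t), x_{t+1} - xstar>
       <= D t - D t.+1 - N (x_{t+1} - x_t)^2 / 2.
   Combined with the descent lemma from [y_t] to [z_{t+1}] and the gradient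
   inequality of [f] at [y_t], this yields, for [e t = f (z t) - f xstar],
     L gamma_t^2 e_{t+1} <= (L gamma_t^2 - gamma_t) e_t + D t - D t.+1.
   The step sizes solve L gamma_{t+1}^2 - gamma_{t+1} = L gamma_t^2, so the
   bound telescopes to L gamma_T^2 e_{T+1} <= D 1, and L gamma_T >= (T+1)/2.
   Since only [x 1 = grad h^* (theta 1)] is assumed at the start, the relation
   [theta 1 \in \partial h (x 1)] has to be derived: a maximizer [x] of
   [<theta, .> - h] exists, and strong convexity at [x] squeezes
   [h^* (theta + v) - h^* theta] between [<v, x>] and [<v, x> + C |v|^2], so
   that [x] is the gradient of [h^*] at [theta]. *)

(** * The scalar product and its sup-norm bound *)

Section Dot.
Context {R : realType} {n : nat}.
Implicit Types (u v w : 'rV[R]_n) (a : R).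

Lemma dotC u v : dot u v = dot v u.
Proof. by apply: eq_bigr => i _; rewrite mulrC. Qed.

Lemma dotDr u v w : dot u (v + w) = dot u v + dot u w.
Proof. by rewrite -big_split; apply: eq_bigr => i _; rewrite mxE mulrDr. Qed.

Lemma dotZr u a v : dot u (a *: v) = a * dot u v.
Proof. by rewrite mulr_sumr; apply: eq_bigr => i _; rewrite mxE mulrCA. Qed.

Lemma dotNr u v : dot u (- v) = - dot u v.
Proof. by rewrite -scaleN1r dotZr mulN1r. Qed.

Lemma dotDl u v w : dot (u + v) w = dot u w + dot v w.
Proof. by rewrite -!(dotC w) dotDr. Qed.

Lemma dotZl a u v : dot (a *: u) v = a * dot u v.
Proof. by rewrite -!(dotC v) dotZr. Qed.

Lemma dotNl u v : dot (- u) v = - dot u v.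
Proof. by rewrite -!(dotC v) dotNr. Qed.

Definition dotE := (dotDl, dotDr, dotNl, dotNr, dotZl, dotZr).

Lemma dot_delta i v : dot (delta_mx ord0 i) v = v ord0 i.
Proof.
rewrite /dot (bigD1 i)//= mxE !eqxx mul1r big1 ?addr0// => j jNi.
by rewrite mxE eqxx (negbTE jNi) mul0r.
Qed.

Lemma ler_coord_norm v i : `|v ord0 i| <= `|v|.
Proof.
rewrite [leRHS]mx_normrE.
exact: (le_bigmax_cond _ (fun ij : 'I_1 * 'I_n => `|v ij.1 ij.2|) (j := (ord0, i))).
Qed.

Lemma dot_le_norm u v : `|dot u v| <= n%:R * (`|u| * `|v|).
Proof.
apply: le_trans (ler_norm_sum _ _ _) _.
rewrite -[n in n%:R]card_ord mulr_natl -sumr_const; apply: ler_sum => i _.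
by rewrite normrM ler_pM ?ler_coord_norm.
Qed.

Lemma dot_cvg u (s : nat -> 'rV[R]_n) v :
  s @ \oo --> v -> dot u (s k) @[k --> \oo] --> dot u v.
Proof.
move=> sv; apply/cvgrPdist_lt => e e0.
have c0 : 0 < n%:R * `|u| + 1 by rewrite ltr_wpDl// mulr_ge0.
have /cvgrPdist_lt/(_ (e / (n%:R * `|u| + 1)) (divr_gt0 e0 c0)) := sv.
apply: filterS => k; rewrite ltr_pdivlMr// => ek.
rewrite -dotNr -dotDr (le_lt_trans (dot_le_norm _ _))// (le_lt_trans _ ek)//.
by rewrite mulrA mulrC ler_wpM2l// lerDl.
Qed.

End Dot.

(** * Arbitrary norms: continuity, equivalence with the sup norm, duality *)

Section Norm.
Context {R : realType} {n : nat} (N : 'rV[R]_n -> R).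
Hypothesis N_norm : is_norm N.
Implicit Types (u v : 'rV[R]_n).

Let N_triangle u v : N (u + v) <= N u + N v. Proof. by case: N_norm. Qed.

Lemma is_normZ a u : N (a *: u) = `|a| * N u. Proof. by case: N_norm. Qed.

Lemma is_norm0 : N 0 = 0.
Proof. by rewrite -(scale0r 0) is_normZ normr0 mul0r. Qed.

Lemma is_normC u v : N (u - v) = N (v - u).
Proof. by rewrite -opprB -scaleN1r is_normZ normrN1 mul1r. Qed.

Lemma is_norm_ge0 u : 0 <= N u.
Proof.
have := N_triangle u (- u).
rewrite subrr is_norm0 -scaleN1r is_normZ normrN1 mul1r; lra.
Qed.

Lemma is_norm_gt0 u : u != 0 -> 0 < N u.
Proof.
move=> u0; rewrite lt_neqAle is_norm_ge0 andbT eq_sym.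
by apply: contra u0 => /eqP Nu0; case: N_norm => _ _ /(_ _ Nu0) ->.
Qed.

Lemma is_norm_le_norm u : N u <= (\sum_i N (delta_mx ord0 i)) * `|u|.
Proof.
rewrite [in leLHS](row_sum_delta u).
apply: (@le_trans _ _ (\sum_i N (u ord0 i *: delta_mx ord0 i))).
  elim/big_ind2 : _ => //; first by rewrite is_norm0.
  by move=> x1 x2 y1 y2 h1 h2; rewrite (le_trans (N_triangle _ _))// lerD.
rewrite mulr_suml; apply: ler_sum => i _.
by rewrite is_normZ mulrC ler_wpM2l ?is_norm_ge0 ?ler_coord_norm.
Qed.

Lemma is_norm_continuous : continuous N.
Proof.
move=> u; apply/(@cvgrPdist_lt _ _ _ (nbhs u)) => e e0.
set C := \sum_i N (delta_mx ord0 i).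
have C0 : 0 < C + 1 by rewrite ltr_wpDl// sumr_ge0// => i _; exact: is_norm_ge0.
have ec : 0 < e / (C + 1) by rewrite divr_gt0.
apply: filterS (nbhsx_ballx u _ ec) => v.
rewrite -ball_normE /= ltr_pdivlMr// => uv.
have h1 := N_triangle (u - v) v; have h2 := N_triangle (v - u) u.
rewrite !subrK (is_normC v) in h1 h2.
have h3 : N (u - v) <= `|u - v| * (C + 1).
  by rewrite (le_trans (is_norm_le_norm _))// mulrC ler_wpM2l// lerDl.
by rewrite (le_lt_trans _ uv)// ler_norml; apply/andP; split; lra.
Qed.

(** The continuous function [N] attains its minimum on the compact sup-norm unit sphere. That
    minimum is positive, and by homogeneity its inverse serves as [M]. *)
Lemma norm_le_is_norm : exists2 M, 0 < M & forall u, `|u| <= M * N u.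
Proof.
pose S := [set u : 'rV[R]_n | `|u| = 1].
(* The sphere is empty when [n = 0]; every vector is then zero. *)
have [[u0 Su0]|S0] := pselect (S !=set0); last first.
  exists 1 => // u; have [->|uN0] := eqVneq u 0.
    by rewrite normr0 mul1r is_norm_ge0.
  exfalso; apply: S0; exists (`|u|^-1 *: u).
  by rewrite /S /= normrZ normfV normr_id mulVf ?normr_eq0.
have cS : compact S.
  apply: bounded_closed_compact.
    by exists 1; split => // x x1 u; rewrite /S /= => ->; exact: ltW.
  apply: (@closed_comp _ _ (fun u : 'rV[R]_n => `|u|) [set 1]) => //.
  by move=> u _; exact: norm_continuous.
have [c cS1 cmin] := @EVT_min_rV R n N S (ex_intro _ u0 Su0) cS
  (continuous_subspaceT is_norm_continuous).
have Nc : 0 < N c.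
  apply: is_norm_gt0; move: cS1; rewrite inE /S /= => c1.
  by rewrite -normr_eq0 c1 oner_neq0.
exists (N c)^-1; first by rewrite invr_gt0.
move=> u; have [->|uN0] := eqVneq u 0; first by rewrite normr0 is_norm0 mulr0.
have u1 : 0 < `|u| by rewrite normr_gt0.
have : N c <= N (`|u|^-1 *: u).
  by apply: cmin; rewrite inE /S /= normrZ normfV normr_id mulVf ?gt_eqF.
rewrite is_normZ normfV normr_id mulrC ler_pdivlMr// => h.
by rewrite mulrC ler_pdivlMr// mulrC.
Qed.

(** The supremum is tested at [(N u)^-1 *: u], a point of norm 1. *)
Lemma dot_le_dual_norm (c : R) v u :
  (dual_norm N v <= c%:E)%E -> dot v u <= c * N u.
Proof.
move=> vc; have [->|uN0] := eqVneq u 0.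
  by rewrite is_norm0 -(scale0r 0) dotZr mul0r mulr0.
have Nu : 0 < N u by exact: is_norm_gt0.
rewrite -ler_pdivrMr// mulrC -dotZr -lee_fin; apply: le_trans vc.
apply: ereal_sup_ubound; exists ((N u)^-1 *: u) => //=.
by rewrite is_normZ normfV ger0_norm ?is_norm_ge0// mulVf ?gt_eqF.
Qed.

End Norm.

(** * Derivatives along segments and the gradient inequality *)

Lemma lineE (R : pzRingType) (V : lmodType R) (u v : V) (s : R) :
  u + s *: (v - u) = s *: v + (1 - s) *: u.
Proof. by rewrite scalerBr scalerBl scale1r addrCA. Qed.

Section Gradient.
Context {R : realType} {n : nat} (f : 'rV[R]_n -> \bar R).
Implicit Types (u v d : 'rV[R]_n).

Lemma derive_gradE u d :
  differentiable_efun f u -> 'D_d (fine \o f) u = dot (grad f u) d.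
Proof.
move=> [_ df]; rewrite deriveE// {1}(row_sum_delta d) linear_sum.
by apply: eq_bigr => i _; rewrite linearZ mxE deriveE// mulrC.
Qed.

Lemma is_derive_segment u d (s : R) : differentiable_efun f (u + s *: d) ->
  is_derive s 1 (fun t : R => fine (f (u + t *: d))) (dot (grad f (u + s *: d)) d).
Proof.
move=> df; have [_ dF] := df.
pose g := cst u + *:%R^~ d : R -> 'rV[R]_n.
have dg : is_diff s g (0 + *:%R^~ d) by apply: is_diffD.
have dFg : is_diff s ((fine \o f) \o g) ('d (fine \o f) (g s) \o (0 + *:%R^~ d)).
  apply: is_diff_comp => //; exact: differentiableP.
have -> : (fun t : R => fine (f (u + t *: d))) = (fine \o f) \o g by [].
apply: DeriveDef; first by apply: diff_derivable; exact: ex_diff.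
rewrite deriveE; last exact: ex_diff.
rewrite diff_val /= -derive_gradE// deriveE//.
by rewrite fctE add0r scale1r.
Qed.

Hypothesis f_notNy : forall u, f u != -oo%E.

Lemma differentiable_efun_fin u : differentiable_efun f u -> f u \is a fin_num.
Proof. by move=> [/nbhs_singleton]. Qed.

(** Convexity bounds the difference quotients of [f] from [u] towards [v] by [f v - f u], and the
    bound passes to the limit. *)
Lemma convex_gradient_le u v : convex_efun f -> differentiable_efun f u ->
  f v \is a fin_num -> fine (f u) + dot (grad f u) (v - u) <= fine (f v).
Proof.
move=> cf df fv; have fu := differentiable_efun_fin df.
have : differentiable_efun f (u + 0 *: (v - u)) by rewrite scale0r addr0.
move=> /is_derive_segment [/[swap]].
rewrite /derivable /derive scale0r addr0 => Dval /cvg_ex[l Dl].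
move: Dval; rewrite (cvg_lim _ Dl)// => <-.
rewrite -lerBrDl.
(* The limit defining the derivative is two-sided; convexity bounds the quotient for increments
   [0 < h < 1], hence the restriction to the right. *)
move/cvg_dnbhs_at_right : Dl => /cvgr_to_le; apply.
near=> h.
have h0 : 0 < h by near: h; exact: nbhs_right_gt.
have h1 : h < 1 by near: h; exact: nbhs_right_lt.
rewrite /= addr0 [h%:A]mulr1 [leLHS]mulrC ler_pdivrMr//.
rewrite lineE.
have h01 : 0 <= h <= 1 by rewrite !ltW.
have := cf v u h h01.
rewrite -(fineK fu) -(fineK fv) -!EFinM -EFinD.
case: (f (h *: v + _)) (f_notNy (h *: v + (1 - h) *: u)) => //= r _.
by rewrite lee_fin => ?; lra.
Unshelve. all: by end_near. Qed.

End Gradient.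

(** * The descent lemma *)

Section Descent.
Context {R : realType} {n : nat} (X : set 'rV[R]_n) (N : 'rV[R]_n -> R).
Context (f : 'rV[R]_n -> \bar R) (L : R).
Hypotheses (X_convex : convex_set X) (N_norm : is_norm N).
Implicit Types (u v : 'rV[R]_n).

Lemma convex_set_comb u v (l : R) :
  X u -> X v -> 0 <= l <= 1 -> X (l *: u + (1 - l) *: v).
Proof.
move=> Xu Xv /andP[l0 l1].
have := X_convex (Itv01 l0 l1) (mem_set Xu) (mem_set Xv).
by rewrite inE.
Qed.

Hypothesis f_diff : forall u, X u -> differentiable_efun f u.
Hypothesis f_smooth : forall u v, X u -> X v ->
  (dual_norm N (grad f u - grad f v)%R <= (L * N (u - v))%:E)%E.

(** The mean value theorem replaces integration along the segment: with the linear and quadratic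
    terms subtracted, the restriction [psi] of [f] has derivative [<grad f (u + s d) - grad f u, d>
    - L s N(d)^2], which is nonpositive by the Lipschitz bound. *)
Lemma descent u v : X u -> X v ->
  fine (f v) <= fine (f u) + dot (grad f u) (v - u) + L / 2 * N (v - u) ^+ 2.
Proof.
move=> Xu Xv.
set d := v - u.
have Xs (s : R) : 0 <= s <= 1 -> X (u + s *: d).
  by move=> s01; rewrite lineE; exact: convex_set_comb.
pose phi (s : R) := fine (f (u + s *: d)).
pose c := L / 2 * N d ^+ 2; pose g0 := dot (grad f u) d.
pose psi : R -> R := phi - (g0 \*: id) - (c \*: (id ^+ 2)).
pose dpsi (s : R) := dot (grad f (u + s *: d)) d - g0 - c * (2 * s).
have psi' (s : R) : 0 <= s <= 1 -> is_derive s 1 psi (dpsi s).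
  move=> s01; have h := is_derive_segment (f_diff (Xs s s01)).
  apply: is_derive_eq.
  by rewrite /dpsi /GRing.scale /= expr1; ring.
have psic : {within `[0, 1], continuous psi}.
  apply: derivable_within_continuous => s s01; apply: ex_derive; exact: psi'.
have [s s01] := MVT_segment ler01 (fun s hs => psi' s (subset_itv_oo_cc hs)) psic.
have psiE t : psi t = fine (f (u + t *: d)) - g0 * t - c * t ^+ 2 by [].
rewrite subr0 mulr1 !psiE scale1r scale0r addr0 [u + d]addrC subrK.
suff : dpsi s <= 0 by rewrite /c/g0; lra.
rewrite in_itv /= in s01; have /andP[s0 s1] := s01.
rewrite /dpsi /g0 -dotNl -dotDl.
have := dot_le_dual_norm N_norm d (f_smooth (Xs s s01) Xu).
rewrite addrAC subrr add0r is_normZ// ger0_norm// /c.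
by nra.
Qed.

End Descent.

(** * Strong convexity, subgradients and the gradient of the conjugate *)

Section Conjugate.
Context {R : realType} {n : nat} (N : 'rV[R]_n -> R) (h : 'rV[R]_n -> \bar R).
Hypotheses (N_norm : is_norm N) (h_notNy : forall x, h x != -oo%E).
Hypothesis h_strong : strongly_convex_efun N h.
Implicit Types (x v theta : 'rV[R]_n).

Lemma dom_fin_num x : dom h x -> h x \is a fin_num.
Proof. by rewrite /dom /= fin_numE h_notNy => /lt_eqF ->. Qed.

(** If [h x] were [+oo], the subgradient inequality at [x0] would have right-hand side [-oo]. *)
Lemma subdifferential_fin_num x0 x theta :
  dom h x0 -> subdifferential h x theta -> h x \is a fin_num.
Proof.
move=> /dom_fin_num /fineK h0 /(_ x0); rewrite -h0.
by case: (h x) (h_notNy x).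
Qed.

Lemma strongly_convex_fine x x' (l : R) :
  h x \is a fin_num -> h x' \is a fin_num -> 0 <= l <= 1 ->
  let u := l *: x + (1 - l) *: x' in
  h u \is a fin_num /\
  fine (h u) <= l * fine (h x) + (1 - l) * fine (h x')
                - l * (1 - l) / 2 * N (x' - x) ^+ 2.
Proof.
move=> hx hx' l01 u.
have : (h u <= (l * fine (h x) + (1 - l) * fine (h x')
                - l * (1 - l) / 2 * N (x' - x) ^+ 2)%:E)%E.
  by rewrite EFinB EFinD !EFinM !fineK//; exact: h_strong.
by case: (h u) (h_notNy u) => //= r _; rewrite lee_fin.
Qed.

(** The subgradient inequality at [u = x + l (x' - x)], combined with strong convexity and divided
    by [l], gives the claim with the quadratic term multiplied by [1 - l]; then [l] tends to 0. *)
Lemma subgradient_strong x x' theta :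
  h x \is a fin_num -> h x' \is a fin_num -> subdifferential h x theta ->
  fine (h x) + dot theta (x' - x) + N (x' - x) ^+ 2 / 2 <= fine (h x').
Proof.
move=> hx hx' dh; apply/ler_addgt0Pr => e e0.
set q := N (x' - x) ^+ 2 / 2.
have q0 : 0 <= q by rewrite divr_ge0 ?exprn_ge0 ?is_norm_ge0.
have q1 : 0 < q + 1 by lra.
(* This choice makes the loss [l * q] at most [e]; [q + 1] avoids a division by zero when
   [q = 0]. *)
pose l := Num.min 1 (e / (q + 1)).
have l0 : 0 < l by rewrite lt_min ltr01 divr_gt0.
have l1 : l <= 1 by rewrite ge_min lexx.
have le : l * q <= e.
  have : l <= e / (q + 1) by rewrite ge_min lexx orbT.
  rewrite ler_pdivlMr//; nra.
have l01 : 0 <= l <= 1 by rewrite ltW.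
have [] := strongly_convex_fine hx' hx l01.
set u := _ + _ => hu hle.
have := dh u; rewrite -(fineK hx) -(fineK hu) -EFinB lee_fin.
have -> : u - x = l *: (x' - x).
  by rewrite /u scalerBl scale1r scalerBr addrCA addrC addrK.
rewrite dotZr => hge; rewrite is_normC// in hle.
rewrite -(ler_pM2l l0); rewrite /q in le *; nra.
Qed.

(* By strong convexity at midpoints, a maximizing sequence of
   [<theta, x> - h x] is Cauchy; semicontinuity makes its limit a maximizer. *)
Lemma subdifferential_exists theta x0 :
  lower_semicontinuous h -> dom h x0 -> dom (conjugate h) theta ->
  exists2 x, h x \is a fin_num & subdifferential h x theta.
Proof.
move=> lsc /dom_fin_num h0 ctheta.
have conj_ge x : h x \is a fin_num ->
    ((dot theta x - fine (h x))%:E <= conjugate h theta)%E.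
  by move=> hx; apply: ereal_sup_ubound; exists x => //; rewrite EFinB fineK.
have cfin : conjugate h theta \is a fin_num.
  rewrite fin_numE (lt_eqF ctheta) andbT gt_eqF//.
  by rewrite (lt_le_trans _ (conj_ge _ h0)) ?ltNyr.
have [S SE] : exists S, conjugate h theta = S%:E.
  by exists (fine (conjugate h theta)); rewrite fineK.
have S_ge x : h x \is a fin_num -> dot theta x - fine (h x) <= S.
  by move=> /conj_ge; rewrite SE lee_fin.
have approx k : exists x, h x \is a fin_num /\
    S - harmonic k < dot theta x - fine (h x).
  have k0 : 0 < (harmonic k : R) by exact: harmonic_gt0.
  have [_ [x _ <-]] := ub_ereal_sup_adherent k0 cfin.
  rewrite -/(conjugate h theta) SE => hlt; exists x.
  by case: (h x) (h_notNy x) hlt => //= r _; rewrite -EFinN -EFinD lte_fin.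
have [s sP] := choice approx.
have s_fin k := (sP k).1; have s_gt k := (sP k).2.
(* The value at the midpoint is at most [S], yet exceeds [S - (harmonic j + harmonic k) / 2 + N (s k
   - s j) ^+ 2 / 8]. *)
have s_dist j k : N (s k - s j) ^+ 2 <= 4 * (harmonic j + harmonic k).
  have half01 : 0 <= (2^-1 : R) <= 1 by apply/andP; split; lra.
  have [] := strongly_convex_fine (s_fin j) (s_fin k) half01.
  set u := _ + _ => hu hle; have := S_ge _ hu.
  by rewrite {1}/u !dotE; have := s_gt j; have := s_gt k; lra.
have [M M0 NM] := norm_le_is_norm N_norm.
have s_cauchy : cauchy_ex (s @ \oo).
  move=> e e0.
  (* Two harmonic terms below this threshold give [N (s k - s j) < e / M] through [s_dist]. *)
  have d0 : 0 < (e / M) ^+ 2 / 8 by rewrite divr_gt0 ?exprn_gt0 ?divr_gt0.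
  have [K _ HK] := cvgr_lt (0 : R) cvg_harmonic _ d0.
  exists (s K), K => // k /= Kk.
  have := HK K (leqnn K); have := HK k Kk => hk hK.
  rewrite -ball_normE /=; apply: le_lt_trans (NM _) _.
  rewrite -ltr_pdivlMl// mulrC.
  rewrite -(ltr_pXn2r (n := 2)) ?nnegrE ?is_norm_ge0 ?divr_ge0 ?ltW//.
  by apply: le_lt_trans (s_dist _ _) _; lra.
have /cauchy_exP/cauchy_cvgP/cvg_ex[x sx] := s_cauchy.
have hx_le : (h x <= (dot theta x - S)%:E)%E.
  rewrite leNgt; apply/negP => hx_gt.
  (* By semicontinuity [h] stays above [a] near the limit [x], whereas [h (s k)] lies below a
     sequence tending to [dot theta x - S < a]. *)
  have [a Sa ha] : exists2 a, dot theta x - S < a & (a%:E < h x)%E.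
    case: (h x) hx_gt => // [r|_].
      rewrite lte_fin => Sr; exists ((dot theta x - S + r) / 2); first by lra.
      by rewrite lte_fin; lra.
    by exists (dot theta x - S + 1); [lra|exact: ltry].
  have [V Vx Va] := lsc _ _ ha.
  have hc : dot theta (s k) - S + harmonic k @[k --> \oo] --> dot theta x - S + 0.
    apply: cvgD; last exact: cvg_harmonic.
    by apply: cvgB; [exact: (dot_cvg sx)|exact: cvg_cst].
  have : a <= dot theta x - S + 0.
    apply: (cvgr_to_ge hc); near=> k.
    have : (a%:E < h (s k))%E by apply: Va; near: k; exact: sx.
    by rewrite -(fineK (s_fin k)) lte_fin; have := s_gt k; lra.
  lra.
have hx : h x \is a fin_num by apply: dom_fin_num; exact: le_lt_trans hx_le (ltry _).
exists x => // x'.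
have [->|hx'] := eqVneq (h x') +oo%E; first by rewrite -(fineK hx) leey.
have hx'f : h x' \is a fin_num by rewrite fin_numE h_notNy.
have := S_ge _ hx'f; move: hx_le.
by rewrite -(fineK hx) -(fineK hx'f) -EFinB !lee_fin !dotE; lra.
Unshelve. all: by end_near. Qed.

(** The lower bound tests the supremum at [x]. For the upper one, moving to [x'] gains at most
    [a b - b^2 / 2 <= a^2 / 2], where [b = N (x' - x)] and [a = n M |v|] comes from comparing the
    norms; hence the constant [C]. *)
Lemma conjugate_subgradient theta x : h x \is a fin_num ->
  subdifferential h x theta -> exists2 C, 0 <= C & forall v,
    ((dot (theta + v) x - fine (h x))%:E <= conjugate h (theta + v) <=
     (dot (theta + v) x - fine (h x) + C * `|v| ^+ 2)%:E)%E.
Proof.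
move=> hx dh; have [M M0 NM] := norm_le_is_norm N_norm.
exists ((n%:R * M) ^+ 2 / 2) => [|v]; first by rewrite divr_ge0 ?sqr_ge0.
apply/andP; split.
  by apply: ereal_sup_ubound; exists x => //; rewrite EFinB fineK.
apply: ge_ereal_sup => _ [x' _ <-].
have [->|hx'] := eqVneq (h x') +oo%E; first by rewrite addeNy leNye.
have hx'f : h x' \is a fin_num by rewrite fin_numE h_notNy.
rewrite -(fineK hx'f) -EFinB lee_fin.
have := subgradient_strong hx hx'f dh.
have h1 : dot v (x' - x) <= n%:R * M * `|v| * N (x' - x).
  apply: le_trans (ler_norm _) _; apply: le_trans (dot_le_norm _ _) _.
  rewrite -!mulrA ler_wpM2l// (mulrCA M) ler_wpM2l//.
have -> : (n%:R * M) ^+ 2 / 2 * `|v| ^+ 2 = (n%:R * M * `|v|) ^+ 2 / 2 by ring.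
move: h1; rewrite !dotE; have := sqr_ge0 (n%:R * M * `|v| - N (x' - x)).
by move: (n%:R * M * `|v|) => a; lra.
Qed.

Lemma grad_conjugate theta x : h x \is a fin_num ->
  subdifferential h x theta -> grad (conjugate h) theta = x.
Proof.
move=> hx /(conjugate_subgradient hx)[C C0 HC].
have conj_fin v : conjugate h (theta + v) \is a fin_num.
  have /andP[l1 l2] := HC v.
  rewrite fin_numE gt_eqF ?(lt_le_trans _ l1) ?ltNyr//.
  by rewrite lt_eqF// (le_lt_trans l2) ?ltry.
have {}HC v : dot v x <= fine (conjugate h (theta + v)) - fine (conjugate h theta)
    <= dot v x + C * `|v| ^+ 2.
  have := HC v; rewrite -(fineK (conj_fin v)) !lee_fin !dotE => /andP[v1 v2].
  (* At [v = 0] both bounds coincide and give the value of the conjugate at [theta]. *)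
  have := HC 0; rewrite -(fineK (conj_fin 0)) !lee_fin normr0 expr0n /= mulr0 !addr0.
  by move=> /andP[w1 w2]; apply/andP; split; lra.
apply/rowP => i; rewrite mxE -[RHS]dot_delta; set v := delta_mx _ _.
apply: cvg_lim => //; apply/cvgrPdist_le => e e0.
have c0 : 0 < C * `|v| ^+ 2 + 1 by rewrite ltr_wpDl// mulr_ge0// sqr_ge0.
near=> t.
have t0 : t != 0 by near: t; exact: nbhs_dnbhs_neq.
have te : `|t| <= e / (C * `|v| ^+ 2 + 1).
  near: t; apply: dnbhs0_le; exact: divr_gt0.
rewrite ler_pdivlMr// in te.
have /andP[] := HC (t *: v).
rewrite /= dotZl normrZ exprMn [theta + _]addrC.
move: (_ - _) => D D1 D2.
(* The squeeze puts [D] within [C t^2 |v|^2] of [t * dot v x], so the quotient errs by at most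
   [C |t| |v|^2]. *)
have -> : dot v x - t^-1 *: D = t^-1 * (t * dot v x - D).
  by rewrite mulrBr mulKf.
rewrite normrM normfV ler_pdivrMl ?normr_gt0// ler0_norm ?subr_le0//.
have t1 : 0 <= `|t| by [].
have v1 : 0 <= C * `|v| ^+ 2 by rewrite mulr_ge0 ?sqr_ge0.
nra.
Unshelve. all: by end_near. Qed.

End Conjugate.

(** * Growth and recurrence of the step sizes *)

Section Stepsize.
Context {R : realType} (L : R) (gamma : nat -> R).
Hypotheses (L_gt0 : 0 < L) (gamma1 : gamma 1%N = 1 / L).
Hypothesis gammaS : forall t, (1 <= t)%N ->
  gamma t.+1 = (2 * L)^-1 * (1 + Num.sqrt (1 + (2 * L * gamma t) ^+ 2)).

(** Since [sqrt (1 + w^2) >= w], the quantity [L * gamma t] grows by at least 1/2 per step, from the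
    value 1 at [t = 1]. *)
Lemma stepsize_ge t : (1 <= t)%N -> t.+1%:R / 2 <= L * gamma t.
Proof.
case: t => // t _; elim: t => [|t IH].
  by rewrite gamma1 mulrCA [L / L]divff ?gt_eqF//; lra.
have L0 : L != 0 by rewrite gt_eqF.
rewrite gammaS//; set w := 2 * L * gamma t.+1.
have w0 : t.+2%:R <= w by rewrite /w -mulrA mulrC -ler_pdivrMr.
have : w <= Num.sqrt (1 + w ^+ 2).
  have w1 : 0 <= w by rewrite (le_trans _ w0).
  by rewrite -[leLHS](ger0_norm w1) -sqrtr_sqr ler_sqrt ?addr_ge0 ?sqr_ge0// lerDr.
move: (Num.sqrt _) => r wr.
have -> : L * ((2 * L)^-1 * (1 + r)) = (1 + r) / 2 by field.
by rewrite -[t.+3%:R]natr1; lra.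
Qed.

(** The formula for [gamma t.+1] is the positive root of this quadratic equation. *)
Lemma stepsize_rec t : (1 <= t)%N ->
  L * gamma t.+1 ^+ 2 - gamma t.+1 = L * gamma t ^+ 2.
Proof.
move=> t1; rewrite gammaS//; set w := 2 * L * gamma t.
have L0 : L != 0 by rewrite gt_eqF.
have : Num.sqrt (1 + w ^+ 2) ^+ 2 = 1 + w ^+ 2.
  by rewrite sqr_sqrtr ?addr_ge0 ?sqr_ge0.
move: (Num.sqrt _) => r r2.
have -> : L * ((2 * L)^-1 * (1 + r)) ^+ 2 - (2 * L)^-1 * (1 + r) =
    (r ^+ 2 - 1) / (4 * L) by field.
by rewrite r2 /w; field.
Qed.

End Stepsize.

(** * Bregman divergences across one prox step *)

Section Step.
Context {R : realType} {n : nat} (N : 'rV[R]_n -> R) (h : 'rV[R]_n -> \bar R).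
Implicit Types (p x theta g : 'rV[R]_n).

Definition fine_bregman x' x theta : R :=
  fine (h x') - fine (h x) - dot theta (x' - x).

Hypotheses (N_norm : is_norm N) (h_notNy : forall x, h x != -oo%E).
Hypothesis h_strong : strongly_convex_efun N h.

Lemma fine_bregman_ge0 x' x theta :
  h x' \is a fin_num -> h x \is a fin_num -> subdifferential h x theta ->
  0 <= fine_bregman x' x theta.
Proof.
move=> hx' hx dh; have := subgradient_strong N_norm h_notNy h_strong hx hx' dh.
by have := sqr_ge0 (N (x' - x)); rewrite /fine_bregman; lra.
Qed.

(** Three-point identity: [D(p,x;theta) - D(p,x';theta') = D(x',x;theta) + <theta' - theta, p -
    x'>]. Strong convexity bounds the first term below, the prox inequality the second. *)
Lemma prox_bregman_le p x x' theta theta' g (c : R) :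
  h x \is a fin_num -> h x' \is a fin_num -> subdifferential h x theta ->
  0 <= dot (theta' - (theta - c *: g)) (p - x') ->
  c * dot g (x' - p) <=
    fine_bregman p x theta - fine_bregman p x' theta' - N (x' - x) ^+ 2 / 2.
Proof.
move=> hx hx' dh.
have := subgradient_strong N_norm h_notNy h_strong hx hx' dh.
by rewrite /fine_bregman !dotE; lra.
Qed.

End Step.

(** * One step of the accelerated method *)

Section AcceleratedStep.
Context {R : realType} {n : nat} (X : set 'rV[R]_n) (N : 'rV[R]_n -> R).
Context (h f : 'rV[R]_n -> \bar R) (L : R).
Hypotheses (X_convex : convex_set X) (N_norm : is_norm N).
Hypotheses (h_notNy : forall x, h x != -oo%E).
Hypotheses (h_strong : strongly_convex_efun N h).
Hypotheses (L_gt0 : 0 < L).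
Hypotheses (f_notNy : forall u, f u != -oo%E) (f_convex : convex_efun f).
Hypothesis f_diff : forall u, X u -> differentiable_efun f u.
Hypothesis f_smooth : forall u v, X u -> X v ->
  (dual_norm N (grad f u - grad f v)%R <= (L * N (u - v))%:E)%E.

(* The quadratic error [L nu^2 N(x' - x)^2 / 2] of the descent lemma at
   [z' - y = nu (x' - x)] is exactly compensated by the strong convexity of [h],
   because [nu = (L c)^-1]. *)
Lemma accelerated_step p x x' z theta theta' (c nu : R) :
  let y := (1 - nu) *: z + nu *: x in
  let z' := (1 - nu) *: z + nu *: x' in
  X p -> X x -> X x' -> X z -> h x \is a fin_num -> h x' \is a fin_num ->
  subdifferential h x theta -> 0 < c -> nu = (L * c)^-1 -> nu <= 1 ->
  0 <= dot (theta' - (theta - c *: grad f y)) (p - x') ->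
  L * c ^+ 2 * (fine (f z') - fine (f p)) <=
    (L * c ^+ 2 - c) * (fine (f z) - fine (f p)) +
    (fine_bregman h p x theta - fine_bregman h p x' theta').
Proof.
move=> y z' Xp Xx Xx' Xz hx hx' dh c0 nuE nu1 vi.
have Lc0 : 0 < L * c by rewrite mulr_gt0.
have nu0 : 0 < nu by rewrite nuE invr_gt0.
have nu01 : 0 <= 1 - nu <= 1 by apply/andP; split; lra.
have Xcomb u : X u -> X ((1 - nu) *: z + nu *: u).
  move=> Xu; have := convex_set_comb X_convex Xz Xu nu01.
  by rewrite subKr.
have Xy : X y := Xcomb _ Xx.
have Xz' : X z' := Xcomb _ Xx'.
have fin u : X u -> f u \is a fin_num.
  by move=> /f_diff; exact: differentiable_efun_fin.
have := prox_bregman_le N_norm h_notNy h_strong hx hx' dh vi.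
have := descent X_convex N_norm f_diff f_smooth Xy Xz'.
have := convex_gradient_le f_notNy f_convex (f_diff Xy) (fin _ Xz).
have := convex_gradient_le f_notNy f_convex (f_diff Xy) (fin _ Xp).
have -> : N (z' - y) = nu * N (x' - x).
  rewrite -(ger0_norm (ltW nu0)) -is_normZ//; congr N.
  by rewrite /z' /y opprD addrACA subrr add0r scalerBr.
(* The split isolates [x' - p], handled by the prox inequality; [z - y] and [p - y] are left to the
   gradient inequality. *)
have gz' : dot (grad f y) (z' - y) = (1 - nu) * dot (grad f y) (z - y) +
    nu * (dot (grad f y) (x' - p) + dot (grad f y) (p - y)).
  by rewrite /z' !dotE; ring.
rewrite gz'.
move: (dot _ (z - y)) (dot _ (p - y)) (dot _ (x' - p)) (N _)
  (fine_bregman _ _ _ _) (fine_bregman _ _ _ _) => a b d q D D'.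
move: (fine (f z')) (fine (f y)) (fine (f z)) (fine (f p)) => fz' fy fz fp.
move=> hp hz hz' hD.
have nuc : L * c * nu = 1 by rewrite nuE divff ?gt_eqF.
(* The weights are [K] for the descent bound, [K - c = K (1 - nu)] for the gradient inequality at
   [z], and [c = K nu] for the one at [p]. *)
set K := L * c ^+ 2.
have Knu : K * nu = c by rewrite /K expr2 mulrA mulrAC nuc mul1r.
have K0 : 0 < K by rewrite mulr_gt0 ?exprn_gt0.
have Kc : 0 <= K - c.
  have -> : K - c = K * (1 - nu) by rewrite mulrBr mulr1 Knu.
  by case/andP: nu01 => ? _; rewrite mulr_ge0 ?(ltW K0).
have Kq : K * (L / 2 * (nu * q) ^+ 2) = q ^+ 2 / 2.
  have -> : K * (L / 2 * (nu * q) ^+ 2) = (L * c * nu) ^+ 2 * (q ^+ 2 / 2).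
    by rewrite /K; ring.
  by rewrite nuc expr1n mul1r.
have := ler_wpM2l (ltW K0) hz'; have := ler_wpM2l (ltW c0) hp.
have := ler_wpM2l Kc hz; rewrite !mulrDr Kq !mulrA mulrBr mulr1 Knu.
by rewrite /K; lra.
Qed.

End AcceleratedStep.

(** * The convergence rate *)

Theorem theorem4p4 (R : realType) (n : nat)
  (X : set 'rV[R]_n) (N : 'rV[R]_n -> R) (h f : 'rV[R]_n -> \bar R)
  (L : R) (xstar : 'rV[R]_n)
  (gamma nu : nat -> R) (x y z theta : nat -> 'rV[R]_n)
  (X_neq0 : X !=set0) (X_closed : closed X) (X_convex : convex_set X)
  (N_norm : is_norm N)
  (h_reg : regularizer X h) (h_strong : strongly_convex_efun N h)
  (L_gt0 : 0 < L)
  (f_notNy : forall u, f u != -oo%E) (f_convex : convex_efun f)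
  (f_C1 : continuously_differentiable_on X f)
  (f_smooth : forall u v, X u -> X v ->
     (dual_norm N (grad f u - grad f v)%R <= (L * N (u - v))%:E)%E)
  (xstar_X : X xstar) (xstar_min : forall u, X u -> (f xstar <= f u)%E)
  (xstar_dom : dom h xstar)
  (gamma1 : gamma 1%N = 1 / L)
  (gammaS : forall t, (1 <= t)%N ->
     gamma t.+1 = (2 * L)^-1 * (1 + Num.sqrt (1 + (2 * L * gamma t) ^+ 2)))
  (nuE : forall t, (1 <= t)%N -> nu t = (L * gamma t)^-1)
  (x1E : x 1%N = grad (conjugate h) (theta 1%N)) (z1E : z 1%N = x 1%N)
  (yE : forall t, (1 <= t)%N -> y t = (1 - nu t) *: z t + nu t *: x t)
  (xS : forall t, (1 <= t)%N ->
     prox X h (theta t - gamma t *: grad f (y t)) (x t.+1, theta t.+1))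
  (zS : forall t, (1 <= t)%N ->
     z t.+1 = (1 - nu t) *: z t + nu t *: x t.+1)
  (T : nat) (T_ge1 : (1 <= T)%N) :
  (f (z T.+1) - f xstar <=
     (4 * L / T.+1%:R ^+ 2)%:E * bregman h xstar (x 1%N) (theta 1%N))%E.
Proof.
have [h_notNy _ h_lsc h_cl h_conj] := h_reg.
have [f_diff _] := f_C1.
have domX u : h u \is a fin_num -> X u.
  move=> hu; rewrite -h_cl; apply: subset_closure.
  by rewrite /dom /= -(fineK hu) ltry.
have [x1_fin x1_sub] : h (x 1%N) \is a fin_num /\
    subdifferential h (x 1%N) (theta 1%N).
  have c1 : dom (conjugate h) (theta 1%N) by rewrite h_conj.
  have [u hu du] := subdifferential_exists N_norm h_notNy h_strong h_lsc xstar_dom c1.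
  by rewrite x1E (grad_conjugate N_norm h_notNy h_strong hu du).
have xP t : (1 <= t)%N -> h (x t) \is a fin_num /\ subdifferential h (x t) (theta t).
  case: t => // -[|t] _ //; have [_ _ /= dh _] := xS t.+1 isT.
  by split=> //; exact: subdifferential_fin_num xstar_dom dh.
have hs := dom_fin_num h_notNy xstar_dom.
have g_ge t (t1 : (1 <= t)%N) := stepsize_ge L_gt0 gamma1 gammaS t1.
have Lg1 t : (1 <= t)%N -> 1 <= L * gamma t.
  move=> t1; apply: le_trans (g_ge t t1).
  by rewrite ler_pdivlMr// mul1r ler_nat.
have g_gt0 t : (1 <= t)%N -> 0 < gamma t.
  by move=> /Lg1 gt; rewrite -(pmulr_rgt0 _ L_gt0) (lt_le_trans ltr01).
have nu01 t : (1 <= t)%N -> 0 <= nu t <= 1.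
  move=> t1; have Lg0 : 0 < L * gamma t by rewrite mulr_gt0 ?g_gt0.
  by rewrite nuE// invr_ge0 (ltW Lg0) invf_le1// Lg1.
have xX t : (1 <= t)%N -> X (x t) by move=> /xP[/domX].
have zX t : (1 <= t)%N -> X (z t).
  elim: t => // -[_ _|t IH _]; first by rewrite z1E; exact: xX.
  rewrite zS// addrC.
  by apply: convex_set_comb => //; [exact: xX|exact: IH|exact: nu01].
pose D t := fine_bregman h xstar (x t) (theta t).
pose e t := fine (f (z t)) - fine (f xstar).
have step t : (1 <= t)%N ->
    L * gamma t ^+ 2 * e t.+1 <= (L * gamma t ^+ 2 - gamma t) * e t + (D t - D t.+1).
  move=> t1; have [ht dht] := xP t t1; have [ht' _] := xP t.+1 isT.
  have [_ _ _ /(_ xstar xstar_X)/= vi] := xS t t1.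
  have /andP[_ nut] := nu01 t t1.
  rewrite /e zS//; rewrite yE// in vi.
  exact: (accelerated_step X_convex N_norm h_notNy h_strong L_gt0 f_notNy f_convex
    f_diff f_smooth xstar_X (xX t t1) (xX t.+1 isT) (zX t t1) ht ht' dht
    (g_gt0 t t1) (nuE t t1) nut vi).
(* The telescoping starts cleanly: [gamma 1 = 1 / L] makes the coefficient of [e 1] vanish. *)
have total t : (1 <= t)%N -> L * gamma t ^+ 2 * e t.+1 <= D 1%N - D t.+1.
  elim: t => // -[_ _|t IH _].
    have := step 1%N isT; rewrite gamma1.
    have -> : L * (1 / L) ^+ 2 - 1 / L = 0 by field; rewrite gt_eqF.
    by rewrite mul0r add0r.
  have := step t.+2 isT; rewrite (stepsize_rec L_gt0 gammaS)//.
  by have := IH isT; lra.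
have f_fin u : X u -> f u \is a fin_num.
  by move=> /f_diff; exact: differentiable_efun_fin.
rewrite -(fineK (f_fin _ (zX T.+1 isT))) -(fineK (f_fin _ xstar_X)).
rewrite /bregman -(fineK hs) -(fineK x1_fin) -!EFinB -EFinM lee_fin.
rewrite -/(e _) -[X in _ * X]/(D 1%N).
have [hT dT] := xP T.+1 isT.
have DT : 0 <= D T.+1.
  exact: (fine_bregman_ge0 N_norm h_notNy h_strong hs hT dT).
(* The sign matters: the lower bound on [L * gamma T] is multiplied by [e T.+1] below. *)
have eT : 0 <= e T.+1.
  rewrite subr_ge0; have := xstar_min _ (zX T.+1 isT).
  by rewrite -(fineK (f_fin _ (zX T.+1 isT))) -(fineK (f_fin _ xstar_X)).
(* With [a = T + 1], the chain is [a^2 e <= 4 (L gamma_T)^2 e = 4 L (L gamma_T^2 e) <= 4 L D_1]. *)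
rewrite mulrAC ler_pdivlMr ?exprn_gt0//.
have := total T T_ge1; have := g_ge T T_ge1.
have := ler0n R T.+1.
move: (T.+1%:R) => a a0 ga tot.
have sq : a ^+ 2 <= 4 * (L * gamma T) ^+ 2.
  have : 0 <= a / 2 by lra.
  nra.
have := ler_wpM2l eT sq.
have := ler_wpM2l (ltW L_gt0) tot.
nra.
Qed.
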